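(* Let $\Phi$ be of type $D_n$ and $W=W(D_n)$. Let $\mathsf{s}_1,\mathsf{s}_2$ be sections of $1\to\mathbb{Z}\Phi\to\mathbb{Z}\Phi\rtimes W\xrightarrow{\pi}W\to1$, with $\mathsf{s}_1(s_i)=\tau_{a_i\alpha_i}s_i$ and $\mathsf{s}_2(s_i)=\tau_{b_i\alpha_i}s_i$, $a_i,b_i\in\mathbb{Z}$, and put $d_i=a_i-b_i$ for $i=1,\dots,n$. Let $I_{n-2}=\{k\in\{1,\dots,n-2\}:k\text{ is odd}\}$. Then $\mathsf{s}_1$ and $\mathsf{s}_2$ define two different elements in $H^1(W,\mathbb{Z}\Phi)$ if and only if at least one of the following holds: (i) $\overline{d_{n-1}}\neq\overline{d_n}$ in $\mathbb{Z}/2\mathbb{Z}$; (ii) $\displaystyle\sum_{k\in I_{n-2}}2\overline{d_k}+n\overline{d_{n-1}}+(n-2)\overline{d_n}\neq0$ in $\mathbb{Z}/4\mathbb{Z}$; (iii) $\displaystyle\sum_{k\in I_{n-2}}2\overline{d_k}+(n-2)\overline{d_{n-1}}+n\overline{d_n}\neq0$ in $\mathbb{Z}/4\mathbb{Z}$.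
   Context: $\Phi$ is the root system of type $D_n$ ($n\ge4$) in a Euclidean space $V$ spanned by it, with simple roots $\alpha_1,\dots,\alpha_n$ numbered so that $\alpha_1,\dots,\alpha_{n-2}$ form a chain in order in the Dynkin diagram and $\alpha_{n-1},\alpha_n$ are both joined to $\alpha_{n-2}$; $W$ is its Weyl group, generated by the simple reflections $s_i=s_{\alpha_i}$. $\mathbb{Z}\Phi$ is the root lattice, with $x\in\mathbb{Z}\Phi$ written as the translation $\tau_x$ in $\mathbb{Z}\Phi\rtimes W$. A section is a group morphism $\mathsf{s}:W\to\mathbb{Z}\Phi\rtimes W$ with $\pi\circ\mathsf{s}=\mathrm{id}_W$; every section is of the form $s_i\mapsto\tau_{k_i\alpha_i}s_i$ for a unique $(k_1,\dots,k_n)\in\mathbb{Z}^n$, and every such tuple occurs. $H^1(W,\mathbb{Z}\Phi)$ is identified with the set of sections up to conjugation by elements of $\mathbb{Z}\Phi$ (a section $\mathsf{s}(g)=\tau_{f(g)}g$ corresponds to the class of the 1-cocycle $f$), so two sections define the same element iff there is $z\in\mathbb{Z}\Phi$ with $\mathsf{s}_2(g)=\tau_z\mathsf{s}_1(g)\tau_{-z}$ for all $g\in W$. Bars denote classes modulo the indicated integer. *)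

(* Defs.v *)
From HB Require Import structures.
From mathcomp Require Import all_boot all_order all_algebra.
From mathcomp Require Import sesquilinear boolp reals.

Set Implicit Arguments.
Unset Strict Implicit.
Unset Printing Implicit Defensive.

Import Order.TTheory GRing.Theory Num.Theory.
Local Open Scope quotient_scope.
Local Open Scope ring_scope.

Section Reflection.
Context {R : realType} {V : vectType R} (dot : {dot V for idfun}).

Definition cartan (v b : V) : R := 2 * dot v b / dot b b.

Definition refl (b v : V) : V := v - cartan v b *: b.

Lemma refl_is_linear b : linear (refl b).
Proof.
move=> k u v; rewrite /refl /cartan linearPl /=.
rewrite scalerBr scalerA addrACA -opprD -scalerDl; congr (_ - _ *: _).
by rewrite mulrDr mulrDl; congr (_ + _); rewrite !mulrA [2 * k]mulrC.
Qed.

HB.instance Definition _ b := GRing.isLinear.Build R V V *:%R (refl b)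
  (refl_is_linear b).

Definition refl_lin (b : V) : 'End(V) := linfun (refl b).

Lemma dot_self_neq0 b : b != 0 -> dot b b != 0.
Proof. by move=> b0; rewrite gt_eqF //; apply: (@neq0_dnorm_gt0 _ _ idfun). Qed.

Lemma reflK b : b != 0 -> involutive (refl b).
Proof.
move=> b0 v; rewrite {1}/refl.
suff -> : cartan (refl b v) b = - cartan v b by rewrite scaleNr opprK subrK.
rewrite {1}/cartan {1}/refl linearBl linearZl_LR /=.
rewrite /cartan (divfK (dot_self_neq0 b0)).
by rewrite [X in _ - X]mulr_natl mulr2n opprD addrA subrr sub0r mulrN mulNr.
Qed.

(* A reduced crystallographic root system spanning V. *)
Record root_system := RootSystem {
  roots :> seq V;
  roots_span : <<roots>>%VS = fullv;
  roots_neq0 : 0 \notin roots;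
  roots_refl : forall b c, b \in roots -> c \in roots -> refl b c \in roots;
  roots_int : forall b c, b \in roots -> c \in roots ->
    cartan c b \is a Num.int;
  roots_reduced : forall (b : V) (k : R), b \in roots -> k *: b \in roots ->
    k = 1 \/ k = -1 }.

End Reflection.

Section RootSystem.
Context {R : realType} {V : vectType R} {dot : {dot V for idfun}}.
Variable Phi : root_system dot.

Definition root_of : Type := seq_sub (roots Phi).

(* Reflections in roots are involutions, so the products of such reflections
   already form a group. *)
Definition in_weyl : {pred 'End(V)} := fun g =>
  `[< exists2 s : seq V, all (mem (roots Phi)) s &
        g = foldr (fun b h => (refl_lin dot b \o h)%VF) \1%VF s >].

Record weyl := Weyl { weyl_lfun :> 'End(V); _ : weyl_lfun \in in_weyl }.

HB.instance Definition _ := [isSub for weyl_lfun].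
HB.instance Definition _ := [Choice of weyl by <:].

Lemma root_neq0 b : b \in roots Phi -> b != 0.
Proof. by apply: contraTneq => ->; exact: roots_neq0. Qed.

Lemma in_weyl1 : \1%VF \in in_weyl.
Proof. by apply/asboolP; exists [::]. Qed.

Lemma in_weylM g h : g \in in_weyl -> h \in in_weyl -> (g \o h)%VF \in in_weyl.
Proof.
move=> /asboolP[s sP ->] /asboolP[t tP ->]; apply/asboolP.
exists (s ++ t); first by rewrite all_cat sP.
elim: s {sP} => [|b s IH] /=; first by rewrite comp_lfun1l.
by rewrite -IH comp_lfunA.
Qed.

Lemma in_weyl_refl b : b \in roots Phi -> refl_lin dot b \in in_weyl.
Proof.
by move=> bP; apply/asboolP; exists [:: b]; rewrite /= ?bP // comp_lfun1r.
Qed.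

Lemma refl_linK b : b \in roots Phi ->
  (refl_lin dot b \o refl_lin dot b)%VF = \1%VF.
Proof.
move=> bP; apply/lfunP => v; rewrite comp_lfunE id_lfunE !lfunE.
by rewrite /= reflK // root_neq0.
Qed.

Lemma in_weyl_inv g : g \in in_weyl ->
  exists2 h, h \in in_weyl & (h \o g)%VF = \1%VF /\ (g \o h)%VF = \1%VF.
Proof.
move=> /asboolP[s sP ->]; elim: s sP => [_|b s IH /= /andP[bP sP]].
  by exists \1%VF; [exact: in_weyl1 | rewrite comp_lfun1l].
have [h hW [hg gh]] := IH sP.
exists (h \o refl_lin dot b)%VF; first by rewrite in_weylM // in_weyl_refl.
split.
  by rewrite comp_lfunA -(comp_lfunA h) refl_linK // comp_lfun1r.
by rewrite comp_lfunA -(comp_lfunA (refl_lin dot b)) gh comp_lfun1r refl_linK.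
Qed.

Lemma in_weylV g : g \in in_weyl -> (g^-1)%VF \in in_weyl /\
  (g^-1 \o g)%VF = \1%VF /\ (g \o g^-1)%VF = \1%VF.
Proof.
move=> /in_weyl_inv[h hW [hg gh]].
have kg : lker g == 0%VS.
  by apply/lker0P => u v uv; rewrite -[u]id_lfunE -[v]id_lfunE -hg !lfunE /= uv.
have Vg := lker0_compVf kg.
have gV : (g^-1)%VF = h by rewrite -[LHS]comp_lfun1r -gh comp_lfunA Vg comp_lfun1l.
by rewrite gV.
Qed.

Definition weyl_one : weyl := Weyl in_weyl1.
Definition weyl_mul (g h : weyl) : weyl := Weyl (in_weylM (valP g) (valP h)).
Definition weyl_inv (g : weyl) : weyl := Weyl (in_weylV (valP g)).1.

Lemma weyl_mulA : associative weyl_mul.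
Proof. by move=> f g h; apply: val_inj => /=; rewrite comp_lfunA. Qed.
Lemma weyl_mul1g : left_id weyl_one weyl_mul.
Proof. by move=> g; apply: val_inj => /=; rewrite comp_lfun1l. Qed.
Lemma weyl_mulg1 : right_id weyl_one weyl_mul.
Proof. by move=> g; apply: val_inj => /=; rewrite comp_lfun1r. Qed.
Lemma weyl_mulVg : left_inverse weyl_one weyl_inv weyl_mul.
Proof. by move=> g; apply: val_inj => /=; case: (in_weylV (valP g)) => _ []. Qed.
Lemma weyl_mulgV : right_inverse weyl_one weyl_inv weyl_mul.
Proof. by move=> g; apply: val_inj => /=; case: (in_weylV (valP g)) => _ []. Qed.

HB.instance Definition _ := isGroup.Build weyl
  weyl_mulA weyl_mul1g weyl_mulg1 weyl_mulVg weyl_mulgV.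

Definition weyl_refl (b : root_of) : weyl := Weyl (in_weyl_refl (valP b)).

Definition in_lattice : {pred V} := fun v =>
  `[< exists c : root_of -> int, v = \sum_(b : root_of) val b *~ c b >].

Lemma in_lattice_zmod : zmod_closed in_lattice.
Proof.
split=> [|u v /asboolP[c ->] /asboolP[d ->]]; apply/asboolP.
  by exists (fun=> 0); rewrite big1 // => b _; rewrite mulr0z.
exists (fun b => c b - d b); rewrite -sumrB.
by apply: eq_bigr => b _; rewrite mulrzBr.
Qed.

HB.instance Definition _ := GRing.isZmodClosed.Build V in_lattice
  in_lattice_zmod.

Record lattice := Lattice { lattice_val :> V; _ : lattice_val \in in_lattice }.

HB.instance Definition _ := [isSub for lattice_val].
HB.instance Definition _ := [Choice of lattice by <:].
HB.instance Definition _ := [SubChoice_isSubZmodule of lattice by <:].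

Lemma in_lattice_root b : b \in roots Phi -> b \in in_lattice.
Proof.
move=> bP; pose b' : root_of := SeqSub bP.
apply/asboolP; exists (fun c => (c == b')%:Z).
rewrite (bigD1 b') //= eqxx mulr1z big1 ?addr0 // => c /negPf->.
by rewrite mulr0z.
Qed.

Definition lattice_root (b : root_of) : lattice := Lattice (in_lattice_root (valP b)).

Lemma in_lattice_weyl (g : weyl) v : v \in in_lattice -> g v \in in_lattice.
Proof.
case: g => /= g /asboolP[s sP ->]; elim: s sP => [_|b s IH /= /andP[bP sP]].
  by rewrite id_lfunE.
move=> /(IH sP); rewrite comp_lfunE; move: (foldr _ _ _) => h; move: (h v) => w.
move=> /asboolP[c ->]; rewrite linear_sum; apply: rpred_sum => r _.
rewrite raddfMz; apply: rpredMz; rewrite /= lfunE /=.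
by apply: in_lattice_root; apply: roots_refl => //; exact: valP.
Qed.

Definition weyl_act (g : weyl) (x : lattice) : lattice :=
  Lattice (in_lattice_weyl g (valP x)).

(* The semidirect product of the root lattice by the Weyl group. *)
Record affine := Affine { aff_trans : lattice; aff_proj : weyl }.

Definition affine_pair (p : affine) := (aff_trans p, aff_proj p).
Definition pair_affine p := Affine p.1 p.2.
Lemma affine_pairK : cancel affine_pair pair_affine.
Proof. by case. Qed.

HB.instance Definition _ := Choice.copy affine (can_type affine_pairK).

Definition aff_one : affine := Affine 0 1%g.
Definition aff_mul (p q : affine) : affine :=
  Affine (aff_trans p + weyl_act (aff_proj p) (aff_trans q))
         (aff_proj p * aff_proj q)%g.
Definition aff_inv (p : affine) : affine :=
  Affine (- weyl_act (aff_proj p)^-1%g (aff_trans p)) (aff_proj p)^-1%g.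

Lemma weyl_actM g h x : weyl_act (g * h)%g x = weyl_act g (weyl_act h x).
Proof. by apply: val_inj; rewrite /= comp_lfunE. Qed.
Lemma weyl_act1 x : weyl_act 1%g x = x.
Proof. by apply: val_inj; rewrite /= id_lfunE. Qed.
Lemma weyl_actD g x y : weyl_act g (x + y) = weyl_act g x + weyl_act g y.
Proof. by apply: val_inj; rewrite /= linearD. Qed.
Lemma weyl_actN g x : weyl_act g (- x) = - weyl_act g x.
Proof. by apply: val_inj; rewrite /= linearN. Qed.
Lemma weyl_act0 g : weyl_act g 0 = 0.
Proof. by apply: val_inj; rewrite /= linear0. Qed.

Lemma aff_mulA : associative aff_mul.
Proof.
by move=> p q r; rewrite /aff_mul /= weyl_actD weyl_actM addrA mulgA.
Qed.
Lemma aff_mul1g : left_id aff_one aff_mul.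
Proof. by case=> x g; rewrite /aff_mul /= weyl_act1 add0r mul1g. Qed.
Lemma aff_mulg1 : right_id aff_one aff_mul.
Proof. by case=> x g; rewrite /aff_mul /= weyl_act0 addr0 mulg1. Qed.
Lemma aff_mulVg : left_inverse aff_one aff_inv aff_mul.
Proof. by case=> x g; rewrite /aff_mul /= addNr mulVg. Qed.
Lemma aff_mulgV : right_inverse aff_one aff_inv aff_mul.
Proof.
by case=> x g; rewrite /aff_mul /= weyl_actN -weyl_actM mulgV weyl_act1 subrr.
Qed.

HB.instance Definition _ := isGroup.Build affine
  aff_mulA aff_mul1g aff_mulg1 aff_mulVg aff_mulgV.

Definition tau (x : lattice) : affine := Affine x 1%g.
Definition aff_of_weyl (g : weyl) : affine := Affine 0 g.

Record section := Section {
  section_fun :> weyl -> affine;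
  section_morph : {morph section_fun : g h / (g * h)%g};
  section_proj : forall g, aff_proj (section_fun g) = g }.

HB.instance Definition _ := gen_eqMixin section.
HB.instance Definition _ := gen_choiceMixin section.

Definition section_conj : rel section := fun s t =>
  `[< exists z : lattice, forall g, t g = (tau z * s g * tau (- z))%g >].

Lemma tauD x y : tau (x + y) = (tau x * tau y)%g.
Proof.
by rewrite /tau -[RHS]/(aff_mul _ _) /aff_mul /= weyl_act1 mulg1.
Qed.

Lemma section_conj_refl : reflexive section_conj.
Proof.
move=> s; apply/asboolP; exists 0 => g.
by rewrite oppr0 mulg1 mul1g.
Qed.

Lemma section_conj_sym : symmetric section_conj.
Proof.
suff H s t : section_conj s t -> section_conj t s.
  by move=> s t; apply/idP/idP; apply: H.
move=> /asboolP[z zP]; apply/asboolP; exists (- z) => g.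
rewrite zP opprK !mulgA -tauD addNr mul1g -mulgA -tauD addNr.
by rewrite mulg1.
Qed.

Lemma section_conj_trans : transitive section_conj.
Proof.
move=> t s u /asboolP[z zP] /asboolP[y yP]; apply/asboolP; exists (y + z) => g.
by rewrite yP zP opprD [- y - z]addrC !tauD !mulgA.
Qed.

Definition section_conj_equiv :=
  EquivRel section_conj section_conj_refl section_conj_sym section_conj_trans.

(* H^1(W, ZPhi), as the set of sections up to conjugation by translations. *)
Definition H1 : Type := {eq_quot section_conj_equiv}.

Definition H1_class (s : section) : H1 := \pi s.

(* Simple roots are indexed by 1, ..., n; the other values of alpha are
   irrelevant. *)
Definition is_base (n : nat) (alpha : nat -> root_of) : Prop :=
  basis_of fullv [seq val (alpha i) | i <- iota 1 n] /\
  forall b : root_of, exists c : nat -> nat,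
    val b = \sum_(1 <= i < n.+1) val (alpha i) *+ c i \/
    val b = - \sum_(1 <= i < n.+1) val (alpha i) *+ c i.

(* Adjacency in the Dynkin diagram D_n, for 1 <= i < j <= n. *)
Definition D_adj (n i j : nat) : bool :=
  ((j == i.+1) && (j <= n - 2)%N) || ((i == n - 2)%N && (n - 2 < j)%N).

(* The number of edges between two vertices of a Dynkin diagram is the product
   of the two Cartan integers; D_n has only simple edges. *)
Definition dynkin_D (n : nat) (alpha : nat -> root_of) : Prop :=
  forall i j, (0 < i)%N -> (i < j)%N -> (j <= n)%N ->
    cartan dot (val (alpha i)) (val (alpha j)) *
    cartan dot (val (alpha j)) (val (alpha i)) = (D_adj n i j)%:R.

End RootSystem.

(* Main.v *)
Require Import Defs.
From mathcomp Require Import all_boot all_order all_algebra.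
From mathcomp Require Import sesquilinear reals.
From mathcomp Require Import boolp zify ring lra.

(** Conjugating by a translation [z] turns the coefficients [a i] of a section
    into [a i + <z, alpha_i^vee>], up to sign. As the simple reflections
    generate [W], the sections are conjugate iff some [z] in the root lattice
    satisfies [<z, alpha_i^vee> = d i] for all [i], i.e. iff the integral linear
    system given by the Cartan matrix of [D_n] has an integral solution. Put
    [m = n - 2]. Along the chain, the coefficients [x_1, ..., x_m] of [z] are
    determined by [x_1], and eliminating them leaves
    [2 x_m = 2 sum_(i <= m) i d_i + m (d_(m+1) + d_(m+2))] together with
    [2 x_(m+1) - x_m = d_(m+1)] and [2 x_(m+2) - x_m = d_(m+2)], whose
    solvability is a congruence mod 2 and a congruence mod 4. *)

Import Order.TTheory GRing.Theory Num.Theory.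
Local Open Scope ring_scope.

(** * Residues and divisibility *)

Lemma intr_Zp_eq0 (m : nat) (z : int) : (1 < m)%N ->
  (z%:~R == 0 :> 'Z_m) = (m %| z)%Z.
Proof.
move=> m_gt1; have natE k : (k%:R == 0 :> 'Z_m) = (m %| k)%N.
  by rewrite -val_eqE /= val_Zp_nat.
by case: z => k; rewrite ?NegzE ?rmorphN ?oppr_eq0 ?dvdzN; apply: natE.
Qed.

(** Modulo 4, [2 * k] is 0 for even [k] and 2 for odd [k]. This links the sum over odd indices in
    the criterion to the weighted sum that elimination produces. *)
Lemma weighted_sum_mod4 (m : nat) (d : nat -> int) :
  exists e : int, 2 * \sum_(1 <= k < m.+1 | odd k) d k =
    2 * \sum_(1 <= k < m.+1) k%:Z * d k + 4 * e.
Proof.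
rewrite big_mkcond; elim: m => [|m [e IH]]; first by exists 0; rewrite !big_geq.
exists (e - (m.+1./2)%:Z * d m.+1).
rewrite !(big_nat_recr m.+1) //= !mulrDr IH.
case: ifP => om.
  have -> : m.+1%:Z = 1 + 2 * (m.+1./2)%:Z by lia.
  ring.
have -> : m.+1%:Z = 2 * (m.+1./2)%:Z by lia.
ring.
Qed.

(** * Integral solutions of the linear system of type [D_n] *)

Section DSystem.
Variables (m : nat) (d : nat -> int).
Hypothesis m_gt1 : (1 < m)%N.

(** The [i]-th equation times [i] telescopes: it is the increment of [(i + 1) x_i - i x_(i+1)] over
    its value at [i - 1]. *)
Lemma D_system_chain (x : nat -> int) :
  x 0%N = 0 ->
  (forall i, (0 < i < m)%N -> 2 * x i - x i.-1 - x i.+1 = d i) ->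
  forall k, (k < m)%N ->
  \sum_(1 <= i < k.+1) i%:Z * d i = k.+1%:Z * x k - k%:Z * x k.+1.
Proof.
move=> x0 xE; elim=> [|k IH] km; first by rewrite big_geq // x0; lia.
rewrite big_nat_recr //= IH; last by lia.
rewrite -xE /=; last by lia.
have -> : k.+2%:Z = k.+1%:Z + 1 by lia.
have -> : k.+1%:Z = k%:Z + 1 by lia.
ring.
Qed.

(* [x 0 = 0] stands for the missing left neighbour of the first node; [m] is
   the branch node, [m.+1] and [m.+2] the two ends of the fork. *)
Lemma D_system_solvable :
  (exists2 x : nat -> int, x 0%N = 0 &
    [/\ forall i, (0 < i < m)%N -> 2 * x i - x i.-1 - x i.+1 = d i,
        2 * x m - x m.-1 - x m.+1 - x m.+2 = d m,
        2 * x m.+1 - x m = d m.+1 &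
        2 * x m.+2 - x m = d m.+2]) <->
  (2 %| d m.+1 - d m.+2)%Z /\
  (4 %| 2 * \sum_(1 <= k < m.+1) k%:Z * d k
        + m.+2%:Z * d m.+1 + m%:Z * d m.+2)%Z.
Proof.
split.
  move=> [x x0 [xE xm x1 x2]].
  have := D_system_chain x x0 xE _ (ltac:(lia) : (m.-1 < m)%N).
  rewrite prednK; last by lia.
  move=> S; split; first by apply/dvdzP; exists (x m.+1 - x m.+2); lia.
  rewrite big_nat_recr /= ?S; last by lia.
  (* After substitution everything but [4 * x m.+1] cancels. *)
  apply/dvdzP; exists (x m.+1).
  rewrite -x1 -x2 -xm (ltac:(lia) : m.-1%:Z = m%:Z - 1).
  rewrite (ltac:(lia) : m.+2%:Z = m%:Z + 2); ring.
move=> [/dvdzP[e eE] /dvdzP[f fE]].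
(* The chain equations force [x k.+1 - x k = x 1 - \sum_(1 <= j <= k) d j], and
   the value [t] of [x 1] is forced by the last three equations. *)
pose t := \sum_(1 <= k < m.+1) d k + d m.+2 + e.
pose u k := \sum_(0 <= i < k) (t - \sum_(1 <= j < i.+1) d j).
have uS k : u k.+1 = u k + (t - \sum_(1 <= j < k.+1) d j).
  by rewrite /u big_nat_recr.
(* Exchange of summations: [d j] occurs in [k - j] of the inner sums. *)
have uE k : u k = k%:Z * (t - \sum_(1 <= j < k.+1) d j)
                  + \sum_(1 <= j < k.+1) j%:Z * d j.
  elim: k => [|k IH]; first by rewrite /u !big_geq //; ring.
  rewrite uS IH [in RHS]big_nat_recr //= [in X in _ = _ + X]big_nat_recr //=.
  rewrite (ltac:(lia) : k.+1%:Z = k%:Z + 1); ring.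
(* This is the fork equation at [m.+1] with end value [f]; the congruence modulo 4 gives it
   doubled. *)
have um : u m = 2 * f - d m.+1.
  have tE : t - \sum_(1 <= j < m.+1) d j = d m.+2 + e by rewrite /t; ring.
  move: (uE m); rewrite tE.
  move: (\sum_(1 <= _ < _) _ * _) fE => S fE.
  have dE : d m.+1 = d m.+2 + e * 2 by lia.
  rewrite (ltac:(lia) : m.+2%:Z = m%:Z + 2) in fE.
  move=> uv.
  suff : 2 * u m = 2 * (2 * f - d m.+1) by lia.
  have -> : 2 * (2 * f - d m.+1) = f * 4 - 2 * d m.+1 by ring.
  rewrite -fE uv dE; ring.
(* As in the forward direction, the quotient by 4 is [x m.+1] and the quotient by 2 is
   [x m.+1 - x m.+2]. *)
exists (fun i => if (i <= m)%N then u i else if i == m.+1 then f else f - e).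
  by rewrite /u big_geq.
have -> : (m.+1 <= m)%N = false by lia.
have -> : (m.+2 <= m)%N = false by lia.
have -> : (m.+2 == m.+1)%N = false by lia.
rewrite leqnn eqxx leq_pred.
split; last first.
- by rewrite um; lia.
- by rewrite um; lia.
- have := uS m.-1; rewrite prednK; last by lia.
  move=> us; have -> : u m.-1 = u m - (t - \sum_(1 <= j < m) d j).
    by rewrite us; ring.
  rewrite um /t big_nat_recr /=; last by lia.
  rewrite (_ : d m.+1 = d m.+2 + e * 2); [ring | lia].
move=> i im.
rewrite (_ : i <= m)%N; last by lia.
rewrite (_ : i < m)%N; last by lia.
rewrite (_ : i.-1 <= m)%N; last by lia.
rewrite uS; have := uS i.-1; rewrite prednK; last by lia.
move=> ->; rewrite [in X in _ - X]big_nat_recr /=; last by lia.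
ring.
Qed.

End DSystem.

(** The two sums modulo 4 differ by [2 * (d m.+1 - d m.+2)], a multiple of 4 once the parities
    agree, so a single congruence modulo 4 covers both. *)
Lemma D_conditions_Zmod (m : nat) (d : nat -> int) :
  (2 %| d m.+1 - d m.+2)%Z /\
  (4 %| 2 * \sum_(1 <= k < m.+1) k%:Z * d k
        + m.+2%:Z * d m.+1 + m%:Z * d m.+2)%Z <->
  ~ [\/ (d m.+1)%:~R <> (d m.+2)%:~R :> 'Z_2,
       \sum_(1 <= k < m.+1 | odd k) 2 * (d k)%:~R
         + m.+2%:R * (d m.+1)%:~R + m%:R * (d m.+2)%:~R <> 0 :> 'Z_4
     | \sum_(1 <= k < m.+1 | odd k) 2 * (d k)%:~R
         + m%:R * (d m.+1)%:~R + m.+2%:R * (d m.+2)%:~R <> 0 :> 'Z_4].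
Proof.
have cast k l : \sum_(1 <= k < m.+1 | odd k) 2 * (d k)%:~R
      + k%:R * (d m.+1)%:~R + l%:R * (d m.+2)%:~R =
    (2 * \sum_(1 <= k < m.+1 | odd k) d k
      + k%:Z * d m.+1 + l%:Z * d m.+2)%:~R :> 'Z_4.
  by rewrite !rmorphD !rmorphM rmorph_sum mulr_sumr.
rewrite !cast; have [e ->] := weighted_sum_mod4 m d.
set s := \sum_(_ <= _ < _) _.
have Z2E : (d m.+1)%:~R = (d m.+2)%:~R :> 'Z_2 <-> (2 %| d m.+1 - d m.+2)%Z.
  by rewrite -(intr_Zp_eq0 2) // rmorphB subr_eq0; split=> /eqP.
have Z4E z : z%:~R = 0 :> 'Z_4 <-> (4 %| z)%Z.
  by rewrite -(intr_Zp_eq0 4) //; split=> /eqP.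
split=> [[pq E1] [[]|[]|[]]|H].
- exact/Z2E.
- apply/Z4E; rewrite (_ : _ + _ = 2 * s + m.+2%:Z * d m.+1 + m%:Z * d m.+2 + e * 4).
    by rewrite rpredD // dvdz_mull.
  by ring.
- move/dvdzP: pq => [f fE].
  apply/Z4E; rewrite (_ : _ + _ = 2 * s + m.+2%:Z * d m.+1 + m%:Z * d m.+2
                                + (e - f) * 4).
    by rewrite rpredD // dvdz_mull.
  rewrite (ltac:(lia) : d m.+1 = d m.+2 + f * 2) (ltac:(lia) : m.+2%:Z = m%:Z + 2).
  ring.
split; first by apply/Z2E; apply: contrapT => ?; apply: H; constructor 1.
have : (4 %| 2 * s + 4 * e + m.+2%:Z * d m.+1 + m%:Z * d m.+2)%Z.
  by apply/Z4E; apply: contrapT => ?; apply: H; constructor 2.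
rewrite (_ : 2 * s + 4 * e + _ + _ = 2 * s + m.+2%:Z * d m.+1 + m%:Z * d m.+2 + e * 4).
  by rewrite rpredDr // dvdz_mull.
by ring.
Qed.

(* [D_adj n i j] holds only for [i < j], so at most one of the three terms is
   nonzero. *)
Definition D_cartan (n i j : nat) : int :=
  2 * (j == i)%:Z - (D_adj n i j)%:Z - (D_adj n j i)%:Z.

(** * Cartan numbers and reflections *)

Section Reflections.
Context {R : realType} {V : vectType R} (dot : {dot V for idfun}).

Lemma dotC (u v : V) : dot u v = dot v u.
Proof. by rewrite hermC expr0 mul1r. Qed.

Lemma dot_gt0 (u : V) : u != 0 -> 0 < dot u u.
Proof. exact: (@neq0_dnorm_gt0 _ _ idfun). Qed.

Lemma reflE (b v : V) : refl_lin dot b v = v - cartan dot v b *: b.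
Proof. by rewrite lfunE. Qed.

Lemma cartanMz (v b : V) (k : int) :
  cartan dot (v *~ k) b = k%:~R * cartan dot v b.
Proof. by rewrite /cartan -scaler_int linearZl_LR /= mulrCA -!mulrA. Qed.

Lemma cartanNl (v b : V) : cartan dot (- v) b = - cartan dot v b.
Proof. by rewrite -[- v]/(v *~ (-1)) cartanMz mulN1r. Qed.

Lemma cartan_sum (I : Type) (r : seq I) (F : I -> V) (b : V) :
  cartan dot (\sum_(i <- r) F i) b = \sum_(i <- r) cartan dot (F i) b.
Proof. by rewrite /cartan linear_sumlz mulr_sumr mulr_suml. Qed.

Lemma cartan_self (b : V) : b != 0 -> cartan dot b b = 2.
Proof. by move=> b0; rewrite /cartan mulfK // dot_self_neq0. Qed.

Lemma refl_linN (b : V) : refl_lin dot (- b) = refl_lin dot b.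
Proof.
apply/lfunP => v; rewrite !reflE /cartan linearNr linearNl linearNr opprK.
by rewrite mulrN mulNr scaleNr scalerN opprK.
Qed.

Lemma refl_isometry (a u v : V) : a != 0 ->
  dot (refl dot a u) (refl dot a v) = dot u v.
Proof.
move=> a0; rewrite /refl linearBl !linearBr /= !linearZl_LR /= !linearZr_LR /=.
have := dot_self_neq0 dot a0; rewrite /cartan (dotC a v) => aa; by field.
Qed.

(** As [refl a] is an isometric involution, pairing [v] with [refl a b] amounts to pairing
    [refl a v] with [b]. *)
Lemma refl_lin_conj (a b : V) : a != 0 ->
  refl_lin dot (refl dot a b) =
  (refl_lin dot a \o (refl_lin dot b \o refl_lin dot a))%VF.
Proof.
move=> a0; apply/lfunP => v; rewrite !comp_lfunE.
rewrite [refl_lin _ a v]lfunE [refl_lin _ b _]lfunE [refl_lin _ a _]lfunE /=.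
rewrite [refl dot b _]/refl linearB linearZ /= reflK // reflE.
congr (_ - _ *: _); rewrite /cartan refl_isometry //.
by rewrite -{1}(reflK dot a0 v) refl_isometry.
Qed.

End Reflections.

(** * Coordinates in simple roots and generation of the Weyl group *)

Section Base.
Context {R : realType} {V : vectType R} {dot : {dot V for idfun}}.
Context (Phi : root_system dot) (n : nat) (alpha : nat -> root_of Phi).
Hypothesis alpha_base : is_base n alpha.

Lemma base_free (e : nat -> R) :
  \sum_(1 <= i < n.+1) e i *: val (alpha i) = 0 ->
  forall i, (0 < i <= n)%N -> e i = 0.
Proof.
case: alpha_base => /basis_free fr _ e0 i /andP[i0 im].
pose X : n.-tuple V := map_tuple (fun i => val (alpha i)) (iota_tuple n 1).
have XE (j : 'I_n) : X`_j = val (alpha j.+1).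
  by rewrite (nth_map 0%N) ?size_iota // nth_iota.
have /freeP/(_ (fun j => e j.+1)) : free X by [].
move=> H; have lt : (i.-1 < n)%N by lia.
have := H _ (Ordinal lt); rewrite /= prednK //; apply.
rewrite -{}[RHS]e0 big_add1 big_mkord; apply: eq_bigr => j _.
by rewrite XE.
Qed.

Lemma base_sum1 (i : nat) (F : nat -> V) : (0 < i <= n)%N ->
  (forall j, (0 < j <= n)%N -> j != i -> F j = 0) ->
  \sum_(1 <= j < n.+1) F j = F i.
Proof.
move=> im F0; rewrite (bigD1_seq i) ?iota_uniq ?mem_index_iota //=.
by rewrite big_seq_cond big1 ?addr0 // => j; rewrite mem_index_iota => /andP[]; auto.
Qed.

Lemma base_delta (i : nat) : (0 < i <= n)%N ->
  \sum_(1 <= j < n.+1) (j == i)%:R *: val (alpha j) = val (alpha i).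
Proof.
move=> im; rewrite (base_sum1 i) ?eqxx ?scale1r //.
by move=> j _ /negPf->; rewrite scale0r.
Qed.

(** A common sign [e] lets positive and negative roots be compared with other expansions in a single
    formula. *)
Lemma root_combination (b : root_of Phi) :
  exists (c : nat -> nat) (e : bool),
    val b = \sum_(1 <= i < n.+1) ((-1) ^+ e * (c i)%:R) *: val (alpha i).
Proof.
have [c [bE|bE]] := alpha_base.2 b; exists c.
  by exists false; rewrite bE; apply: eq_bigr => i _; rewrite mul1r scaler_nat.
exists true; rewrite bE -sumrN; apply: eq_bigr => i _.
by rewrite mulN1r scaleNr scaler_nat.
Qed.

Lemma base_neq0 i : val (alpha i) != 0.
Proof. exact/root_neq0/valP. Qed.

(* Otherwise the reflection of alpha_i in alpha_j would be alpha_i - alpha_j,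
   whose coefficients have mixed signs. *)
Lemma base_cartan_neq1 i j : (0 < i <= n)%N -> (0 < j <= n)%N -> i != j ->
  cartan dot (val (alpha i)) (val (alpha j)) <> 1.
Proof.
move=> im jm ij C1.
have := roots_refl (valP (alpha j)) (valP (alpha i)).
rewrite /refl C1 scale1r => bP.
have [c [e /= bE]] := root_combination (SeqSub bP).
have co k : (0 < k <= n)%N ->
    (k == i)%:R - (k == j)%:R - (-1) ^+ e * (c k)%:R = 0 :> R.
  apply: (base_free (fun k =>
    (k == i)%:R - (k == j)%:R - (-1) ^+ e * (c k)%:R)).
  under eq_bigr => l _ do rewrite !scalerBl.
  by rewrite !sumrB !base_delta // -bE subrr.
have := co i im; have := co j jm; rewrite !eqxx eq_sym (negPf ij).
have /= := ler0n R (c i); have /= := ler0n R (c j).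
by case: e {bE co}; rewrite ?expr1 ?expr0 /=; lra.
Qed.

Lemma lattice_combination (v : V) : v \in in_lattice Phi <->
  exists x : nat -> int, v = \sum_(1 <= i < n.+1) val (alpha i) *~ x i.
Proof.
split; last first.
  move=> [x ->]; apply: rpred_sum => i _; apply: rpredMz.
  exact: in_lattice_root (valP (alpha i)).
move=> /asboolP[c ->]; apply: (big_ind (fun v => exists x : nat -> int,
  v = \sum_(1 <= i < n.+1) val (alpha i) *~ x i)).
- by exists (fun=> 0); rewrite big1 // => i _; rewrite mulr0z.
- move=> _ _ [x ->] [y ->]; exists (fun i => x i + y i).
  by rewrite -big_split; apply: eq_bigr => i _; rewrite mulrzDr.
move=> b _; have [k [e ->]] := root_combination b.
exists (fun i => (-1) ^+ e * (k i)%:Z * c b).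
rewrite -scaler_int scaler_sumr; apply: eq_bigr => i _.
by rewrite -scaler_int scalerA !intrM rmorphXn rmorphN1 mulrC.
Qed.

(* Height induction: a positive root [b] that is not simple has positive inner
   product with some [alpha i], and reflecting it there lowers its height. *)
Lemma weyl_ind (P : weyl Phi -> Prop) :
  P 1%g -> (forall i, (0 < i <= n)%N -> P (weyl_refl (alpha i))) ->
  (forall g h, P g -> P h -> P (g * h)%g) -> forall g, P g.
Proof.
move=> P1 Pa PM.
have reflN (b c : root_of Phi) : val b = - val c -> weyl_refl b = weyl_refl c.
  by move=> bc; apply: val_inj; rewrite /= bc refl_linN.
have pos N (b : root_of Phi) (c : nat -> nat) :
    val b = \sum_(1 <= i < n.+1) val (alpha i) *+ c i ->
    (\sum_(1 <= i < n.+1) c i < N)%N -> P (weyl_refl b).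
  elim: N b c => // N IH b c bE cN.
  have [i [im bi0]] :
      exists i, (0 < i <= n)%N /\ 0 < dot (val b) (val (alpha i)).
    (* If no such [i] existed, expanding one factor of [dot b b] would make it nonpositive. *)
    apply: contrapT => H.
    have := dot_gt0 dot (val b) (root_neq0 (valP b)).
    rewrite {2}bE linear_sumr ltNge big_seq sumr_le0 // => i.
    rewrite mem_index_iota => im; rewrite linearMnr mulrn_wle0 //.
    by rewrite leNgt; apply/negP => bi; apply: H; exists i.
  have /intrP[k kE] := roots_int (valP (alpha i)) (valP b).
  have k0 : 0 < k.
    rewrite -(ltr0z R) -kE /cartan divr_gt0 ?dot_gt0 ?base_neq0 //.
    by rewrite mulr_gt0.
  have gP := roots_refl (valP (alpha i)) (valP b).
  pose g : root_of Phi := SeqSub gP.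
  have gE : val g = val b - k%:~R *: val (alpha i) by rewrite /= /refl kE.
  have bg : weyl_refl b =
      (weyl_refl (alpha i) * (weyl_refl g * weyl_refl (alpha i)))%g.
    apply: val_inj => /=; rewrite -refl_lin_conj ?base_neq0 //.
    by rewrite reflK ?base_neq0.
  have [c' [e gc]] := root_combination g.
  have co j : (0 < j <= n)%N ->
      (c j)%:R - k%:~R * (j == i)%:R - (-1) ^+ e * (c' j)%:R = 0 :> R.
    apply: (base_free (fun j =>
      (c j)%:R - k%:~R * (j == i)%:R - (-1) ^+ e * (c' j)%:R)).
    under eq_bigr => l _ do rewrite !scalerBl -scalerA [(c l)%:R *: _]scaler_nat.
    by rewrite !sumrB -bE -scaler_sumr base_delta // -gc gE subrr.
  have k0R : 1 <= k%:~R :> R by rewrite ler1z; lia.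
  (* Only the coefficient at [i] differs between [b] and [g]. If [g] is negative, all other
     coefficients of [b] vanish, and reducedness makes [b] equal to [alpha i]. *)
  case: e gc co => gc co.
    have c0 j : (0 < j <= n)%N -> j != i -> c j = 0%N.
      move=> jm /negPf ji; have := co j jm; rewrite ji expr1 mulN1r mulr0.
      move=> H; apply/eqP; rewrite -(pnatr_eq0 R); apply/eqP.
      have /= := ler0n R (c j); have /= := ler0n R (c' j); lra.
    have bE1 : val b = (c i)%:R *: val (alpha i).
      rewrite bE scaler_nat (base_sum1 i) // => j jm ji.
      by rewrite (c0 j jm ji) mulr0n.
    suff -> : b = alpha i by exact: Pa.
    apply: val_inj; rewrite bE1.
    have := valP b; rewrite bE1 => /(roots_reduced (valP (alpha i)))[->|].
      by rewrite scale1r.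
    by move=> ci; have := ler0n R (c i); rewrite ci ler0N1.
  rewrite bg; apply: (PM); first exact: Pa; apply: (PM); last exact: Pa.
  apply: (IH _ c').
    by rewrite gc; apply: eq_bigr => j _; rewrite mul1r scaler_nat.
  rewrite -ltnS; apply: leq_trans cN; rewrite ltnS.
  (* As [k >= 1], the coefficient at [i] drops by at least 1 and the others stay, so the height
     decreases. *)
  have leq j : (0 < j <= n)%N -> (c' j + (j == i) <= c j)%N.
    move=> /co; rewrite expr0 mul1r => H.
    rewrite -(ler_nat R) natrD; case: eqP H => _ /= H; lra.
  rewrite [X in (_ <= X)%N](bigD1_seq i) ?iota_uniq ?mem_index_iota //=.
  rewrite (bigD1_seq i) ?iota_uniq ?mem_index_iota //= -addSn leq_add //.
    by have := leq i im; rewrite eqxx addn1.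
  rewrite big_seq_cond [X in (_ <= X)%N]big_seq_cond.
  apply: leq_sum => j; rewrite mem_index_iota => /andP[jm ji].
  by have := leq j jm; rewrite (negPf ji) addn0.
have Prefl (b : root_of Phi) : P (weyl_refl b).
  have [c [bE|bE]] := alpha_base.2 b; first exact: pos bE (ltnSn _).
  (* [- b] is the image of [b] under its own reflection, and it defines the same reflection. *)
  have NbP : - val b \in (Phi : seq V).
    have := roots_refl (valP b) (valP b).
    rewrite /refl cartan_self ?(root_neq0 (valP b)) // -[2]/(2%:R) scaler_nat mulr2n.
    by rewrite opprD addrA subrr sub0r.
  rewrite -(reflN (SeqSub NbP)) //.
  by apply: pos (ltnSn _); rewrite /= bE opprK.
case=> g gW; have /asboolP[s] := gW.
elim: s g gW => [|b s IH] g gW /=.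
  by move=> _ gE; rewrite (_ : Weyl gW = 1%g) //; apply: val_inj.
move=> /andP[bP sP] gE.
have hW : foldr (fun b h => (refl_lin dot b \o h)%VF) \1%VF s \in in_weyl Phi.
  by apply/asboolP; exists s.
rewrite (_ : Weyl gW = (weyl_refl (SeqSub bP) * Weyl hW)%g); last exact: val_inj.
by apply: (PM) => //; apply: IH.
Qed.

(** * Sections and conjugation by translations *)

Lemma tau_affE (x : lattice Phi) (g : weyl Phi) :
  (tau x * aff_of_weyl g)%g = Affine x g.
Proof. by rewrite -[LHS]/(aff_mul _ _) /aff_mul /= weyl_act0 addr0 mul1g. Qed.

(** The cocycle changes by the coboundary [z - g z]. *)
Lemma tau_conjE (x z : lattice Phi) (g : weyl Phi) :
  (tau z * Affine x g * tau (- z))%g = Affine (z + x - weyl_act g z) g.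
Proof.
rewrite -[LHS]/(aff_mul (aff_mul _ _) _) /aff_mul /=.
by rewrite weyl_act1 mul1g mulg1 weyl_actN.
Qed.

Lemma section1 (s : section Phi) : s 1%g = 1%g.
Proof. by apply: (mulgI (s 1%g)); rewrite -section_morph !mulg1. Qed.

(** Both [s2] and the conjugate of [s1] are multiplicative, so conjugacy need only be tested on the
    simple reflections. *)
Lemma H1_class_eqP (s1 s2 : section Phi) (a b : nat -> int)
    (s1E : forall i, (0 < i <= n)%N ->
      s1 (weyl_refl (alpha i)) =
        (tau (lattice_root (alpha i) *~ a i)
           * aff_of_weyl (weyl_refl (alpha i)))%g)
    (s2E : forall i, (0 < i <= n)%N ->
      s2 (weyl_refl (alpha i)) =
        (tau (lattice_root (alpha i) *~ b i)
           * aff_of_weyl (weyl_refl (alpha i)))%g) :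
  H1_class s1 = H1_class s2 <->
  exists2 z, z \in in_lattice Phi & forall i, (0 < i <= n)%N ->
    cartan dot z (val (alpha i)) = (a i - b i)%:~R.
Proof.
have -> : (H1_class s1 = H1_class s2) <-> section_conj s1 s2.
  by split=> [/eqmodP //|?]; apply/eqmodP.
(* For a simple reflection the coboundary is [<z, alpha_i^vee> alpha_i], so the condition is
   [a i + <z, alpha_i^vee> = b i]; the sought vector is [- z]. *)
have conjE z i : (0 < i <= n)%N ->
    s2 (weyl_refl (alpha i)) = (tau z * s1 (weyl_refl (alpha i)) * tau (- z))%g
    <-> cartan dot (- val z) (val (alpha i)) = (a i - b i)%:~R.
  move=> im; rewrite s1E // s2E // !tau_affE tau_conjE.
  have zE : z + lattice_root (alpha i) *~ a i - weyl_act (weyl_refl (alpha i)) z =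
      lattice_root (alpha i) *~ b i <->
      (cartan dot (val z) (val (alpha i)) + (a i - b i)%:~R) *: val (alpha i) = 0.
    have -> : (cartan dot (val z) (val (alpha i)) + (a i - b i)%:~R)
          *: val (alpha i) =
        val (z + lattice_root (alpha i) *~ a i
             - weyl_act (weyl_refl (alpha i)) z - lattice_root (alpha i) *~ b i).
      rewrite 2![in RHS]raddfB [in RHS]raddfD ![in RHS]raddfMz /= reflE opprB mulNrz.
      rewrite scalerDl scaler_int mulrzBr [LHS]addrA; congr (_ - _).
      by rewrite [val z + _]addrC addrACA subrr addr0 addrC.
    split=> [->|]; first by rewrite subrr.
    by move=> H; apply/eqP; rewrite -subr_eq0; apply/eqP/val_inj.
  split=> [[/esym/zE/eqP]|zc].
    rewrite scaler_eq0 (negPf (base_neq0 _)) orbF cartanNl => /eqP; lra.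
  congr Affine; apply/esym/zE; rewrite -zc cartanNl subrr scale0r //.
split.
  move=> /asboolP[z zP]; exists (- val z); first by rewrite rpredN; exact: valP.
  by move=> i im; apply/conjE.
move=> [z zL zE]; apply/asboolP; exists (- Lattice zL); apply: weyl_ind.
- by rewrite !section1 mulg1 -tauD subrr.
- by move=> i im; apply/conjE => //=; rewrite opprK zE.
move=> g h gE hE; rewrite !section_morph gE hE !mulgA.
by rewrite -(mulgA _ (tau (- _)) (tau _)) -tauD addNr mulg1.
Qed.

(** * The Cartan matrix of type [D_n] *)

Lemma base_cartanE (alpha_D : dynkin_D n alpha) i j :
  (0 < i <= n)%N -> (0 < j <= n)%N ->
  cartan dot (val (alpha j)) (val (alpha i)) = (D_cartan n i j)%:~R.
Proof.
have ltE k l : (0 < k)%N -> (k < l)%N -> (l <= n)%N ->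
    cartan dot (val (alpha k)) (val (alpha l)) = - (D_adj n k l)%:R /\
    cartan dot (val (alpha l)) (val (alpha k)) = - (D_adj n k l)%:R.
  move=> k0 kl ln; have := alpha_D k l k0 kl ln.
  have km : (0 < k <= n)%N by lia.
  have lm : (0 < l <= n)%N by lia.
  (* The diagram gives only the product of two Cartan integers. Product 0 forces orthogonality;
     product 1 makes both equal to 1 or both to -1, and [base_cartan_neq1] excludes 1. *)
  case: (D_adj n k l) => /= H; last first.
    have kl0 : dot (val (alpha k)) (val (alpha l)) = 0.
      move/eqP: H; rewrite mulf_eq0 /cartan !mulf_eq0 !invr_eq0 pnatr_eq0 /=.
      rewrite (dotC dot (val (alpha l)) (val (alpha k))).
      by rewrite !(negPf (dot_self_neq0 dot (base_neq0 _))) !orbF orbb => /eqP.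
    rewrite /cartan [dot (val (alpha l)) (val (alpha k))]dotC kl0.
    by rewrite !mulr0 !mul0r oppr0.
  have p1 := base_cartan_neq1 k l km lm (ltac:(lia)).
  have /intrP[p pE] := roots_int (valP (alpha l)) (valP (alpha k)).
  have /intrP[q qE] := roots_int (valP (alpha k)) (valP (alpha l)).
  move: H p1; rewrite pE qE -intrM => /eqP.
  rewrite (eqr_int R (p * q) 1) => /eqP pq p1.
  have {}p1 : p <> 1 by move=> pp; apply: p1; rewrite pp.
  have : (absz p == 1)%N && (absz q == 1)%N by rewrite -muln_eq1 -abszM pq.
  move=> /andP[p1q q1p]; have pE1 : p = -1 by lia.
  have qE1 : q = -1 by rewrite pE1 in pq; lia.
  by rewrite pE1 qE1.
move=> im jm; rewrite /D_cartan !rmorphB rmorphM /=.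
have Dn k l : (l <= k)%N -> D_adj n k l = false by rewrite /D_adj; lia.
case: (ltngtP i j) => ij.
- rewrite (ltE i j _ ij _).2; [|lia|lia].
  by rewrite (Dn j i) ?mulr0; [rewrite subr0 sub0r|lia].
- rewrite (ltE j i _ ij _).1; [|lia|lia].
  by rewrite (Dn i j) ?mulr0; [rewrite subr0 sub0r|lia].
by rewrite ij cartan_self ?base_neq0 // Dn // !subr0 mulr1.
Qed.

Lemma cartan_combination (alpha_D : dynkin_D n alpha) (x : nat -> int) i :
  (0 < i <= n)%N ->
  cartan dot (\sum_(1 <= j < n.+1) val (alpha j) *~ x j) (val (alpha i)) =
  (\sum_(1 <= j < n.+1) x j * D_cartan n i j)%:~R.
Proof.
move=> im; rewrite cartan_sum rmorph_sum; apply: eq_big_nat => j jm.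
by rewrite cartanMz base_cartanE // rmorphM.
Qed.

End Base.

Section DCartan.
Variables (m : nat) (x : nat -> int).
Hypothesis (m_gt1 : (1 < m)%N) (x0 : x 0%N = 0).

(** The index 0 lies outside the summation range but is allowed because [x 0 = 0]; the first node
    then has a left neighbour like the others. *)
Lemma sum_delta k : (k <= m.+2)%N ->
  \sum_(1 <= j < m.+3) x j * (j == k)%:Z = x k.
Proof.
case: k => [_|k km].
  rewrite x0 big_nat big1 // => j; case: j => // j _.
  by rewrite mulr0.
rewrite (bigD1_seq k.+1) ?iota_uniq ?mem_index_iota //= eqxx mulr1.
by rewrite big1 ?addr0 // => j /negPf->; rewrite mulr0.
Qed.

Local Notation Cx i := (\sum_(1 <= j < m.+3) x j * D_cartan m.+2 i j).

Lemma D_cartan_sum :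
  [/\ forall i, (0 < i < m)%N -> Cx i = 2 * x i - x i.-1 - x i.+1,
      Cx m = 2 * x m - x m.-1 - x m.+1 - x m.+2,
      Cx m.+1 = 2 * x m.+1 - x m &
      Cx m.+2 = 2 * x m.+2 - x m].
Proof.
(* A row has at most four nonzero entries, the maximum being reached at the branch node; shorter
   rows are padded with zero coefficients at index 0. *)
have sumE (a b c d : int) i k l p (C : nat -> int) :
    (i <= m.+2)%N -> (k <= m.+2)%N -> (l <= m.+2)%N -> (p <= m.+2)%N ->
    (forall j, (0 < j <= m.+2)%N ->
      C j = a * (j == i)%:Z + b * (j == k)%:Z + c * (j == l)%:Z
            + d * (j == p)%:Z) ->
    \sum_(1 <= j < m.+3) x j * C j = a * x i + b * x k + c * x l + d * x p.
  move=> im km lm pm CE.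
  rewrite -!sum_delta // !mulr_sumr -!big_split; apply: eq_big_nat => j jm /=.
  by rewrite CE //; ring.
rewrite /D_cartan /D_adj; split=> [i im|||].
- by rewrite (sumE 2 (-1) (-1) 0 i i.-1 i.+1 0%N); [ring|lia..].
- by rewrite (sumE 2 (-1) (-1) (-1) m m.-1 m.+1 m.+2); [ring|lia..].
- by rewrite (sumE 2 (-1) 0 0 m.+1 m 0%N 0%N); [ring|lia..].
- by rewrite (sumE 2 (-1) 0 0 m.+2 m 0%N 0%N); [ring|lia..].
Qed.

End DCartan.

(** * The criterion for two sections to have distinct cohomology classes *)

Theorem proposition3p5 (R : realType) (V : vectType R) (dot : {dot V for idfun})
    (Phi : root_system dot) (n : nat) (alpha : nat -> root_of Phi)
    (n_ge4 : (4 <= n)%N) (alpha_base : is_base n alpha)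
    (alpha_D : dynkin_D n alpha)
    (s1 s2 : section Phi) (a b : nat -> int)
    (s1E : forall i, (1 <= i <= n)%N ->
      s1 (weyl_refl (alpha i)) =
        (tau (lattice_root (alpha i) *~ a i)
           * aff_of_weyl (weyl_refl (alpha i)))%g)
    (s2E : forall i, (1 <= i <= n)%N ->
      s2 (weyl_refl (alpha i)) =
        (tau (lattice_root (alpha i) *~ b i)
           * aff_of_weyl (weyl_refl (alpha i)))%g) :
  let d i := a i - b i in
  H1_class s1 <> H1_class s2 <->
  [\/ (d (n - 1)%N)%:~R <> (d n)%:~R :> 'Z_2,
      \sum_(1 <= k < (n - 2).+1 | odd k) 2 * (d k)%:~R
        + n%:R * (d (n - 1)%N)%:~R + (n - 2)%:R * (d n)%:~R <> 0 :> 'Z_4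
    | \sum_(1 <= k < (n - 2).+1 | odd k) 2 * (d k)%:~R
        + (n - 2)%:R * (d (n - 1)%N)%:~R + n%:R * (d n)%:~R <> 0 :> 'Z_4].
Proof.
move=> d.
case: n n_ge4 alpha_base alpha_D s1E s2E => [|[|m]] // m_ge.
move=> alpha_base alpha_D s1E s2E.
have m_gt1 : (1 < m)%N by lia.
rewrite !subSS !subn0.
suff eqE : H1_class s1 = H1_class s2 <->
    (2 %| d m.+1 - d m.+2)%Z /\
    (4 %| 2 * \sum_(1 <= k < m.+1) k%:Z * d k
          + m.+2%:Z * d m.+1 + m%:Z * d m.+2)%Z.
  by rewrite eqE D_conditions_Zmod; split=> [/contrapT|? ?].
rewrite (H1_class_eqP _ _ _ alpha_base _ _ _ _ s1E s2E) -D_system_solvable //.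
have systemE x : x 0%N = 0 ->
    (forall i, (0 < i <= m.+2)%N ->
      cartan dot (\sum_(1 <= j < m.+3) val (alpha j) *~ x j) (val (alpha i)) =
      (d i)%:~R) <->
    [/\ forall i, (0 < i < m)%N -> 2 * x i - x i.-1 - x i.+1 = d i,
        2 * x m - x m.-1 - x m.+1 - x m.+2 = d m,
        2 * x m.+1 - x m = d m.+1 &
        2 * x m.+2 - x m = d m.+2].
  move=> x0; have [Si Sm Sp Sq] := D_cartan_sum m x m_gt1 x0.
  split=> [zE|[xi xm xp xq] i im].
    have {}zE i : (0 < i <= m.+2)%N ->
        \sum_(1 <= j < m.+3) x j * D_cartan m.+2 i j = d i.
      move=> im; apply: (@intr_inj R).
      by rewrite -zE // (cartan_combination _ _ _ alpha_base alpha_D).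
    split=> [i im|||]; last by rewrite -zE ?Sq //; lia.
    - by rewrite -zE ?Si //; lia.
    - by rewrite -zE ?Sm //; lia.
    - by rewrite -zE ?Sp //; lia.
  rewrite (cartan_combination _ _ _ alpha_base alpha_D) //; congr intmul.
  have [im1|] := boolP (i < m)%N; first by rewrite Si ?xi //; lia.
  rewrite -leqNgt leq_eqVlt => /predU1P[<-|im1]; first by rewrite Sm.
  have [->|->] : i = m.+1 \/ i = m.+2 by lia.
    by rewrite Sp.
  by rewrite Sq.
split=> [[z /(lattice_combination _ _ _ alpha_base)[y ->] zE]
        |[x x0 /(systemE x x0) xE]].
  (* The sum starts at 1, so the value of [y] at 0 is arbitrary and can be reset to 0. *)
  exists (fun j => if j is 0%N then 0 else y j) => //.
  apply/systemE => // i im; rewrite -zE //; congr cartan.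
  by apply: eq_big_nat => -[].
exists (\sum_(1 <= j < m.+3) val (alpha j) *~ x j) => //.
by apply/(lattice_combination _ _ _ alpha_base); exists x.
Qed.
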